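(* Let $\mathcal{C}$ be a category and let $W$ be a class of arrows of $\mathcal{C}$ such that: (1) $W$ contains all identities; (2) for any pair of composable arrows $v\colon B\to C$, $w\colon C\to D$ in $W$ there is an arrow $u\colon A\to B$ such that $wvu\in W$; (3) for any arrow $w\in W$ and any arrow $f$ with the same codomain as $w$, there are an arrow $w'\in W$ and an arrow $f'$ such that $wf'=fw'$ (in particular, the composites are defined); (4) if $w\in W$ and $f_1,f_2$ are parallel arrows with $wf_1=wf_2$, then there is an arrow $w'\in W$ such that $f_1w'=f_2w'$. Then $W$ allows for the construction of a category of right fractions $\mathcal{C}[W^{-1}]$.
   Context: A category of right fractions $\mathcal{C}[W^{-1}]$ is a localization of $\mathcal{C}$ at $W$ (a category with a functor $\mathcal{C}\to\mathcal{C}[W^{-1}]$ which is universal among functors sending the arrows in $W$ to isomorphisms) which has the following concrete description. Its objects are those of $\mathcal{C}$; its arrows $A\to B$ are equivalence classes of single spans $A\xleftarrow{w}C\xrightarrow{f}B$ with $w\in W$, where $(w,f)$ and $(w',f')$ are equivalent iff there are arrows $s,t$ with $ws=w't\in W$ and $fs=f't$. The composite of the classes of $A\xleftarrow{w_1}C\xrightarrow{f_1}B$ and $B\xleftarrow{w_2}D\xrightarrow{f_2}E$ is the class of $(w_1w_2',f_2f_1')$ for any arrows $w_2',f_1'$ with $w_2f_1'=f_1w_2'$ and $w_1w_2'\in W$. The functor $\mathcal{C}\to\mathcal{C}[W^{-1}]$ is the identity on objects and sends $f\colon A\to B$ to the class of $(1_A,f)$. *)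

(* Defs.v *)
From Stdlib Require Import RelationClasses.

Set Implicit Arguments.
Unset Strict Implicit.
Unset Printing Implicit Defensive.

Declare Scope cat_scope.
Delimit Scope cat_scope with cat.
Local Open Scope cat_scope.

(** The structure is separated from the underlying graph so that a category
    with prescribed objects and arrows can be spoken of without equality of
    types. *)
Record cat_structure (O : Type) (H : O -> O -> Type) := CatStructure {
  cs_id : forall A, H A A;
  cs_comp : forall A B C, H B C -> H A B -> H A C;
  cs_id_left : forall A B (f : H A B), cs_comp (cs_id B) f = f;
  cs_id_right : forall A B (f : H A B), cs_comp f (cs_id A) = f;
  cs_assoc : forall A B C D (h : H C D) (g : H B C) (f : H A B),
    cs_comp h (cs_comp g f) = cs_comp (cs_comp h g) f
}.

Record category := Category {
  obj :> Type;
  hom : obj -> obj -> Type;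
  cat_str : cat_structure hom
}.

Definition idt (C : category) (A : C) : hom A A := cs_id (cat_str C) A.

Definition comp (C : category) (A B D : C) (g : hom B D) (f : hom A B) :
  hom A D := cs_comp (cat_str C) g f.

Notation "g ∘ f" := (comp g f) (at level 40, left associativity) : cat_scope.

Definition is_iso (C : category) (A B : C) (f : hom A B) : Prop :=
  exists g : hom B A, g ∘ f = idt A /\ f ∘ g = idt B.

Record is_functor (C D : category) (fo : C -> D)
    (fa : forall A B : C, hom A B -> hom (fo A) (fo B)) : Prop := IsFunctor {
  is_functor_id : forall A : C, fa A A (idt A) = idt (fo A);
  is_functor_comp : forall (A B E : C) (g : hom B E) (f : hom A B),
    fa A E (g ∘ f) = fa B E g ∘ fa A B f
}.

Record functor (C D : category) := Functor {
  fun_obj :> C -> D;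
  fun_hom : forall A B : C, hom A B -> hom (fun_obj A) (fun_obj B);
  fun_laws : is_functor fun_hom
}.

Lemma functor_comp_laws (C D E : category) (G : functor D E)
  (F : functor C D) :
  is_functor (fo := fun A => G (F A))
    (fun A B (f : hom A B) => fun_hom G (fun_hom F f)).
Proof.
destruct (fun_laws F) as [F1 F2], (fun_laws G) as [G1 G2].
split; intros.
- now rewrite F1, G1.
- now rewrite F2, G2.
Qed.

Definition functor_comp (C D E : category) (G : functor D E)
  (F : functor C D) : functor C E := Functor (functor_comp_laws G F).

Definition arrow_class (C : category) := forall A B : C, hom A B -> Prop.

Definition inverts (C D : category) (W : arrow_class C) (F : functor C D) :
  Prop := forall (A B : C) (w : hom A B), W A B w -> is_iso (fun_hom F w).

(** Factorizations are up to equality of functors, not merely up to natural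
    isomorphism. *)
Record is_localization (C L : category) (W : arrow_class C)
    (Q : functor C L) : Prop := IsLocalization {
  loc_inverts : inverts W Q;
  loc_universal : forall (D : category) (F : functor C D), inverts W F ->
    exists! G : functor L D, functor_comp G Q = F
}.

Section Fractions.
Variables (C : category) (W : arrow_class C).

Record span (A B : C) := Span {
  apex : C;
  denom : hom apex A;
  numer : hom apex B;
  denom_in : W denom
}.

Definition span_equiv (A B : C) (x y : span A B) : Prop :=
  exists (X : C) (s : hom X (apex x)) (t : hom X (apex y)),
    denom x ∘ s = denom y ∘ t /\ W (denom x ∘ s) /\
    numer x ∘ s = numer y ∘ t.

(** The quotient of spans, realized as the set of equivalence classes; that
    [span_equiv] is an equivalence relation is part of [right_fractions]. *)
Definition fraction (A B : C) : Type :=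
  {P : span A B -> Prop | exists x, P = span_equiv x}.

Definition span_class (A B : C) (x : span A B) : fraction A B :=
  exist _ (span_equiv x) (ex_intro _ x eq_refl).

Record right_fractions := RightFractions {
  rf_equiv : forall A B : C, Equivalence (@span_equiv A B);
  rf_str : cat_structure fraction;
  rf_cat : category := Category rf_str;
  (** Without this, [rf_comp] could hold vacuously. *)
  rf_square : forall (A B E : C) (x : span A B) (y : span B E),
    exists (X : C) (w : hom X (apex x)) (f : hom X (apex y)),
      denom y ∘ f = numer x ∘ w /\ W (denom x ∘ w);
  rf_comp : forall (A B E : C) (x : span A B) (y : span B E)
      (X : C) (w : hom X (apex x)) (f : hom X (apex y))
      (Ww : W (denom x ∘ w)),
    denom y ∘ f = numer x ∘ w ->
    cs_comp rf_str (span_class y) (span_class x) =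
    span_class (Span (numer y ∘ f) Ww);
  (** Needed for (1, f) to be a span. *)
  rf_id_in : forall A : C, W (idt A);
  rf_functor_laws : is_functor (C := C) (D := rf_cat) (fo := fun A => A)
    (fun A B (f : hom A B) => span_class (Span f (rf_id_in A)));
  rf_functor : functor C rf_cat := Functor rf_functor_laws;
  rf_localization : is_localization W rf_functor
}.

End Fractions.

(* Main.v *)
From Stdlib Require Import RelationClasses FunctionalExtensionality
  PropExtensionality ProofIrrelevance ClassicalEpsilon.
Require Import Defs.
Local Open Scope cat_scope.

(** Two spans are equivalent as soon as they have a common refinement whose
    denominator is in [W].  By (2), a composite of arrows of [W] can always be
    corrected to an arrow of [W] by precomposition, so every diagram chase may
    refine along arbitrary composites of arrows of [W] and correct once at the
    end.  The second ingredient is that, by (3) and (4), an arrow [p] with [d]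
    and [d ∘ p] in [W] satisfies the Ore condition even if [p] is not in [W].
    A functor [F] inverting [W] extends to the fraction of [x] as the unique
    [g] with [g ∘ F (denom x) = F (numer x)], an equation that every extension
    of [F] has to satisfy. *)

Set Implicit Arguments.
Unset Strict Implicit.

(** * Identities for categories and functors *)

Lemma compA (C : category) (A B D E : C) (h : hom D E) (g : hom B D)
  (f : hom A B) : h ∘ (g ∘ f) = h ∘ g ∘ f.
Proof. apply cs_assoc. Qed.

Lemma comp1l (C : category) (A B : C) (f : hom A B) : idt B ∘ f = f.
Proof. apply cs_id_left. Qed.

Lemma comp1r (C : category) (A B : C) (f : hom A B) : f ∘ idt A = f.
Proof. apply cs_id_right. Qed.

Lemma comp_whisker (C : category) (A B B' D E : C) (h : hom D E)
  (g : hom B D) (f : hom A B) (g' : hom B' D) (f' : hom A B') :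
  g ∘ f = g' ∘ f' -> h ∘ g ∘ f = h ∘ g' ∘ f'.
Proof. intros e; rewrite <- !compA; now rewrite e. Qed.

Lemma iso_epi (C : category) (A B D : C) (f : hom A B) (g h : hom B D) :
  is_iso f -> g ∘ f = h ∘ f -> g = h.
Proof.
intros [k [_ fk]] e.
now rewrite <- (comp1r g), <- (comp1r h), <- fk, !compA, e.
Qed.

Lemma fun_id (C D : category) (F : functor C D) (A : C) :
  fun_hom F (idt A) = idt (F A).
Proof. apply (is_functor_id (fun_laws F)). Qed.

Lemma fun_comp (C D : category) (F : functor C D) (A B E : C) (g : hom B E)
  (f : hom A B) : fun_hom F (g ∘ f) = fun_hom F g ∘ fun_hom F f.
Proof. apply (is_functor_comp (fun_laws F)). Qed.

(** Fixing a common object map avoids transporting arrows along equalities of objects. *)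
Lemma functor_eq (C D : category) (fo : C -> D)
  (fa fa' : forall A B : C, hom A B -> hom (fo A) (fo B))
  (l : is_functor fa) (l' : is_functor fa') :
  (forall A B (f : hom A B), fa A B f = fa' A B f) -> Functor l = Functor l'.
Proof.
intros e.
assert (fa = fa') as <-.
{ apply functional_extensionality_dep; intros A.
  apply functional_extensionality_dep; intros B.
  apply functional_extensionality; intros f; apply e. }
f_equal; apply proof_irrelevance.
Qed.

(** * Refinements and equivalence of spans *)

Section RightFractions.

Variables (C : category) (W : arrow_class C).
Hypotheses
  (W_id : forall A : C, W (idt A))
  (W_comp : forall (B D E : C) (v : hom B D) (w : hom D E),
    W v -> W w -> exists (A : C) (u : hom A B), W (w ∘ v ∘ u))
  (W_ore : forall (A B D : C) (w : hom A D) (f : hom B D), W w ->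
    exists (X : C) (w' : hom X B) (f' : hom X A), W w' /\ w ∘ f' = f ∘ w')
  (W_cancel : forall (A B D : C) (w : hom B D) (f1 f2 : hom A B), W w ->
    w ∘ f1 = w ∘ f2 -> exists (X : C) (w' : hom X A), W w' /\ f1 ∘ w' = f2 ∘ w').

(** Condition (3) is applied over [E], to [d ∘ p] and [d ∘ q]; (4) then cancels [d], and (2) merges
    the two refinements of [D] into one. *)
Lemma W_lift (A B D E : C) (d : hom B E) (p : hom A B) (q : hom D B) :
  W d -> W (d ∘ p) ->
  exists (X : C) (c : hom X D) (a : hom X A), W c /\ p ∘ a = q ∘ c.
Proof.
intros Wd Wdp.
destruct (W_ore (d ∘ q) Wdp) as (Y & w & a & Ww & e).
rewrite <- !compA in e.
destruct (W_cancel Wd e) as (Z & v & Wv & e').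
destruct (W_comp Wv Ww) as (X & u & Wu).
exists X, (w ∘ v ∘ u), (a ∘ v ∘ u); split; [exact Wu|].
rewrite !compA in *; now rewrite e'.
Qed.

Lemma span_equiv_intro (A B : C) (x y : span W A B) (X : C)
  (s : hom X (apex x)) (t : hom X (apex y)) :
  W (denom x ∘ s) -> denom x ∘ s = denom y ∘ t ->
  numer x ∘ s = numer y ∘ t -> span_equiv x y.
Proof. intros; now exists X, s, t. Qed.

Lemma span_equiv_same (A B X : C) (d d' : hom X A) (n n' : hom X B)
  (Wd : W d) (Wd' : W d') : d = d' -> n = n' ->
  span_equiv (Span n Wd) (Span n' Wd').
Proof.
intros <- <-; apply (@span_equiv_intro _ _ (Span n Wd) (Span n Wd') _
  (idt X) (idt X)); simpl; rewrite ?comp1r; auto.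
Qed.

Lemma span_equiv_equivalence (A B : C) : Equivalence (@span_equiv C W A B).
Proof.
split.
- intros [X d n Wd]; now apply span_equiv_same.
- intros x y (X & s & t & e & Ws & e').
  apply (span_equiv_intro (s := t) (t := s)); congruence.
- intros x y z (X & s & t & e & Ws & e') (X' & s' & t' & f & Ws' & f').
  (* Possibly [t] is not in [W], but [denom y ∘ t] equals [denom x ∘ s], which is; so [s'] can be
     lifted against [t]. *)
  destruct (@W_lift _ _ _ _ (denom y) t s' (denom_in y))
    as (Y & c & a & Wc & g); [congruence|].
  destruct (W_comp Wc Ws') as (Z & u & Wu).
  assert (h : denom x ∘ (s ∘ a ∘ u) = denom y ∘ s' ∘ c ∘ u).
  { rewrite !compA, e; f_equal; now apply comp_whisker. }
  apply (span_equiv_intro (s := s ∘ a ∘ u) (t := t' ∘ c ∘ u)).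
  + now rewrite h.
  + now rewrite h, f, !compA.
  + rewrite !compA, e', <- f'; f_equal; now apply comp_whisker.
Qed.

Lemma span_class_eq (A B : C) (x y : span W A B) :
  span_equiv x y -> span_class x = span_class y.
Proof.
intros xy; destruct (span_equiv_equivalence A B) as [_ Sym Tr].
apply subset_eq_compat.
apply functional_extensionality; intros z; apply propositional_extensionality.
split; intros h; eauto.
Qed.

Lemma span_class_inj (A B : C) (x y : span W A B) :
  span_class x = span_class y -> span_equiv x y.
Proof.
intros e; apply (f_equal (@proj1_sig _ _)) in e; simpl in e; rewrite e.
apply span_equiv_equivalence.
Qed.

Lemma fraction_rep (A B : C) (P : fraction W A B) :
  exists x : span W A B, P = span_class x.
Proof.
destruct P as [P [x e]]; exists x; subst P; reflexivity.
Qed.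

(** * Composition of fractions *)

Lemma span_square (A B E : C) (x : span W A B) (y : span W B E) :
  exists (X : C) (w : hom X (apex x)) (f : hom X (apex y)),
    denom y ∘ f = numer x ∘ w /\ W (denom x ∘ w).
Proof.
destruct (W_ore (numer x) (denom_in y)) as (X & w & f & Ww & e).
destruct (W_comp Ww (denom_in x)) as (Y & u & Wu).
exists Y, (w ∘ u), (f ∘ u); rewrite !compA, e; auto.
Qed.

Lemma composite_equiv (A B E : C) (x x' : span W A B) (y y' : span W B E)
  (X X' : C) (w : hom X (apex x)) (f : hom X (apex y))
  (w' : hom X' (apex x')) (f' : hom X' (apex y'))
  (Ww : W (denom x ∘ w)) (Ww' : W (denom x' ∘ w')) :
  span_equiv x x' -> span_equiv y y' ->
  denom y ∘ f = numer x ∘ w -> denom y' ∘ f' = numer x' ∘ w' ->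
  span_equiv (Span (numer y ∘ f) Ww) (Span (numer y' ∘ f') Ww').
Proof.
intros (S & s & t & ed & Ws & en) (S' & s' & t' & ed' & Ws' & en') sq sq'.
(* Over successive refinements, [c1] matches [w] with [s], [c2] matches [w'] with [t], and [c3]
   matches [f] with [s']. *)
destruct (W_lift s (denom_in x) Ww) as (Z1 & c1 & a & Wc1 & e1).
destruct (W_lift (t ∘ c1) (denom_in x') Ww') as (Z2 & c2 & b & Wc2 & e2).
destruct (W_lift (f ∘ a ∘ c2) (denom_in y) Ws') as (Z3 & c3 & e & Wc3 & e3).
(* The last match, of [f'] with [t'], needs no lifting: the two sides already agree after
   [denom y'], so (4) equalizes them by [c4]. *)
assert (h : denom y' ∘ (t' ∘ e) = denom y' ∘ (f' ∘ b ∘ c3)).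
{ rewrite !compA, <- ed', sq', <- (compA (denom y)), e3, !compA, sq.
  rewrite <- (compA (numer x) w a), e1, compA, en.
  rewrite <- (compA (numer x') w' b), e2, !compA; reflexivity. }
destruct (W_cancel (denom_in y') h) as (Z4 & c4 & Wc4 & e4).
(* (2) only corrects at the source, so the composite is built from the right. *)
destruct (W_comp Wc4 Wc3) as (U1 & u1 & Wu1).
destruct (W_comp Wu1 Wc2) as (U2 & u2 & Wu2).
destruct (W_comp Wu2 Wc1) as (U3 & u3 & Wu3).
destruct (W_comp Wu3 Ws) as (U4 & u4 & Wu4).
set (u := u1 ∘ u2 ∘ u3 ∘ u4).
assert (hd : denom x ∘ w ∘ (a ∘ c2 ∘ c3 ∘ c4 ∘ u) =
  denom x ∘ s ∘ (c1 ∘ (c2 ∘ (c3 ∘ c4 ∘ u1) ∘ u2) ∘ u3) ∘ u4).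
{ unfold u; rewrite !compA, (comp_whisker _ e1); reflexivity. }
apply (@span_equiv_intro _ _ (Span (numer y ∘ f) Ww)
  (Span (numer y' ∘ f') Ww') _ (a ∘ c2 ∘ c3 ∘ c4 ∘ u) (b ∘ c3 ∘ c4 ∘ u));
  simpl.
- now rewrite hd.
- rewrite hd; unfold u; rewrite !compA, (comp_whisker _ e2), !compA, ed.
  reflexivity.
- transitivity (numer y ∘ (f ∘ a ∘ c2 ∘ c3) ∘ c4 ∘ u); [now rewrite !compA|].
  rewrite <- e3, compA, en', <- (compA (numer y') t' e).
  rewrite <- (compA (numer y') _ c4), e4, !compA; reflexivity.
Qed.

(** A single [R] serves all representatives and all squares, so the composite obtained from it by
    choice satisfies the computation rule for each of them. *)
Lemma composite_exists (A B E : C) (Q : fraction W B E) (P : fraction W A B) :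
  exists R : fraction W A E,
    forall (x : span W A B) (y : span W B E) (X : C) (w : hom X (apex x))
      (f : hom X (apex y)) (Ww : W (denom x ∘ w)),
    P = span_class x -> Q = span_class y -> denom y ∘ f = numer x ∘ w ->
    R = span_class (Span (numer y ∘ f) Ww).
Proof.
destruct (fraction_rep P) as [x ->], (fraction_rep Q) as [y ->].
destruct (span_square x y) as (X & w & f & sq & Ww).
exists (span_class (Span (numer y ∘ f) Ww)).
intros x' y' X' w' f' Ww' ex ey sq'.
apply span_class_eq, composite_equiv; auto using span_class_inj.
Qed.

Definition fraction_comp (A B E : C) (Q : fraction W B E)
  (P : fraction W A B) : fraction W A E :=
  proj1_sig (constructive_indefinite_description _ (composite_exists Q P)).

Lemma fraction_compE (A B E : C) (x : span W A B) (y : span W B E) (X : C)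
  (w : hom X (apex x)) (f : hom X (apex y)) (Ww : W (denom x ∘ w)) :
  denom y ∘ f = numer x ∘ w ->
  fraction_comp (span_class y) (span_class x) =
  span_class (Span (numer y ∘ f) Ww).
Proof.
unfold fraction_comp.
destruct (constructive_indefinite_description _ _) as [R h]; simpl; auto.
Qed.

Definition fraction_of (A B : C) (f : hom A B) : fraction W A B :=
  span_class (Span f (W_id A)).

(** The square has identity denominators, so only the numerator changes. This yields the left
    identity law, functoriality and one half of the inversion of [W]. *)
Lemma fraction_comp_of_r (A B E X : C) (n : hom X B) (d : hom X E) (Wd : W d)
  (f : hom B A) :
  fraction_comp (fraction_of f) (span_class (Span n Wd)) =
  span_class (Span (f ∘ n) Wd).
Proof.
assert (Wd1 : W (denom (Span n Wd) ∘ idt X)) by (simpl; now rewrite comp1r).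
unfold fraction_of.
rewrite (@fraction_compE _ _ _ (Span n Wd) (Span f (W_id B)) X (idt X) n Wd1).
- apply span_class_eq, span_equiv_same; simpl; auto using comp1r.
- simpl; now rewrite comp1l, comp1r.
Qed.

Lemma fraction_comp_id_l (A B : C) (P : fraction W A B) :
  fraction_comp (fraction_of (idt B)) P = P.
Proof.
destruct (fraction_rep P) as [[X d n Wd] ->].
rewrite fraction_comp_of_r.
apply span_class_eq, span_equiv_same; auto using comp1l.
Qed.

Lemma fraction_comp_id_r (A B : C) (P : fraction W A B) :
  fraction_comp P (fraction_of (idt A)) = P.
Proof.
destruct (fraction_rep P) as [[X d n Wd] ->].
assert (Wd' : W (idt A ∘ d)) by (now rewrite comp1l).
unfold fraction_of.
rewrite (@fraction_compE _ _ _ (Span (idt A) (W_id A)) (Span n Wd) X d (idt X)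
  Wd').
- apply span_class_eq, span_equiv_same; simpl; auto using comp1l, comp1r.
- simpl; now rewrite comp1l, comp1r.
Qed.

(** A square for [y] and [z], then one for [x] and their composite, suffice: pasted together, they
    compute both bracketings with denominator [denom x ∘ w] and numerator [numer z ∘ q ∘ f], up to
    an identity. *)
Lemma fraction_comp_assoc (A B D E : C) (R : fraction W D E)
  (Q : fraction W B D) (P : fraction W A B) :
  fraction_comp R (fraction_comp Q P) = fraction_comp (fraction_comp R Q) P.
Proof.
destruct (fraction_rep P) as [x ->], (fraction_rep Q) as [y ->],
  (fraction_rep R) as [z ->].
destruct (span_square y z) as (Y & p & q & sq & Wp).
destruct (span_square x (Span (numer z ∘ q) Wp)) as (X & w & f & sq' & Ww).
simpl in sq'.
assert (Ww1 : W (denom x ∘ w ∘ idt X)) by (now rewrite comp1r).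
rewrite (fraction_compE Wp sq), 
  (@fraction_compE _ _ _ x (Span (numer z ∘ q) Wp) X w f Ww sq').
rewrite (@fraction_compE _ _ _ x y X w (p ∘ f) Ww) by (now rewrite compA).
rewrite (@fraction_compE _ _ _ (Span (numer y ∘ (p ∘ f)) Ww) z X (idt X)
  (q ∘ f) Ww1) by (simpl; now rewrite comp1r, !compA, sq).
apply span_class_eq, span_equiv_same; simpl; auto using compA, comp1r.
Qed.

(** * The category of fractions and its canonical functor *)

Definition fraction_str : cat_structure (@fraction C W) :=
  @CatStructure C (@fraction C W) (fun A => fraction_of (idt A))
    (@fraction_comp) (@fraction_comp_id_l) (@fraction_comp_id_r)
    (@fraction_comp_assoc).

Definition fraction_cat : category := Category fraction_str.

Lemma fraction_of_laws :
  is_functor (C := C) (D := fraction_cat) (fo := fun A => A) fraction_of.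
Proof.
split; [reflexivity|]; intros A B E g f.
symmetry; apply fraction_comp_of_r.
Qed.

Definition fraction_functor : functor C fraction_cat :=
  Functor fraction_of_laws.

(** Two identity arrows complete the square. With an identity numerator this inverts [denom x] on
    the left; in general it determines every extension of a functor. *)
Lemma fraction_of_denom (A B : C) (x : span W A B) :
  fraction_comp (span_class x) (fraction_of (denom x)) =
  fraction_of (numer x).
Proof.
assert (W1 : W (idt (apex x) ∘ idt (apex x))) by (now rewrite comp1r).
unfold fraction_of.
rewrite (@fraction_compE _ _ _ (Span (denom x) (W_id _)) x _ (idt _) (idt _) W1)
  by reflexivity.
apply span_class_eq, span_equiv_same; auto using comp1r.
Qed.

Lemma fraction_functor_inverts : inverts W fraction_functor.
Proof.
intros A B w Ww.
exists (span_class (Span (idt A) Ww)); split.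
- apply (fraction_of_denom (Span (idt A) Ww)).
- change (fraction_comp (fraction_of w) (span_class (Span (idt A) Ww)) =
    fraction_of (idt B)).
  rewrite fraction_comp_of_r.
  (* The span with both legs [w] refines the identity span along [w]. *)
  apply span_class_eq, (@span_equiv_intro _ _ (Span (w ∘ idt A) Ww)
    (Span (idt B) (W_id B)) _ (idt A) w); simpl;
    rewrite ?comp1r, ?comp1l; auto.
Qed.

(** * The universal property *)

Section Universal.

Variables (D : category) (F : functor C D).
Hypothesis F_inverts : inverts W F.

Lemma fraction_lift_exists (A B : C) (P : fraction W A B) :
  exists g : hom (F A) (F B), forall x : span W A B, P = span_class x ->
    g ∘ fun_hom F (denom x) = fun_hom F (numer x).
Proof.
destruct (fraction_rep P) as [x ->].
destruct (F_inverts (denom_in x)) as (k & kd & _).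
assert (hx : fun_hom F (numer x) ∘ k ∘ fun_hom F (denom x) =
  fun_hom F (numer x)) by (now rewrite <- compA, kd, comp1r).
exists (fun_hom F (numer x) ∘ k); intros y e.
revert hx; generalize (fun_hom F (numer x) ∘ k); intros g hx.
destruct (span_class_inj e) as (X & s & t & ed & Ws & en).
destruct (F_inverts (denom_in y)) as (k' & kd' & _).
assert (hy : fun_hom F (numer y) ∘ k' ∘ fun_hom F (denom y) =
  fun_hom F (numer y)) by (now rewrite <- compA, kd', comp1r).
rewrite <- hy at 1; f_equal.
(* The common denominator lies in [W], so its image is epi; after it, both candidates become the
   image of the common numerator. *)
apply (iso_epi (F_inverts Ws)).
rewrite fun_comp at 1; rewrite compA, hx, <- fun_comp, en.
now rewrite ed, !fun_comp, !compA, hy.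
Qed.

Definition fraction_lift (A B : C) (P : fraction W A B) : hom (F A) (F B) :=
  proj1_sig (constructive_indefinite_description _ (fraction_lift_exists P)).

Lemma fraction_liftE (A B : C) (x : span W A B) :
  fraction_lift (span_class x) ∘ fun_hom F (denom x) = fun_hom F (numer x).
Proof.
unfold fraction_lift.
destruct (constructive_indefinite_description _ _) as [g h]; simpl; auto.
Qed.

Lemma fraction_lift_uniq (A B : C) (x : span W A B) (g : hom (F A) (F B)) :
  g ∘ fun_hom F (denom x) = fun_hom F (numer x) ->
  fraction_lift (span_class x) = g.
Proof.
intros e; apply (iso_epi (F_inverts (denom_in x))).
now rewrite fraction_liftE.
Qed.

Lemma fraction_lift_laws :
  is_functor (C := fraction_cat) (D := D) (fo := fun A => F A) fraction_lift.
Proof.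
split.
- intros A; apply (@fraction_lift_uniq _ _ (Span (@idt C A) (W_id A))).
  apply comp1l.
- intros A B E Q P.
  destruct (fraction_rep P) as [x ->], (fraction_rep Q) as [y ->].
  destruct (span_square x y) as (X & w & f & sq & Ww).
  change (@comp fraction_cat A B E (span_class y) (span_class x)) with
    (fraction_comp (span_class y) (span_class x)).
  rewrite (fraction_compE Ww sq); apply fraction_lift_uniq; simpl.
  (* The lift of [x] turns [denom x] into [numer x]; the square trades [numer x ∘ w] for
     [denom y ∘ f], which the lift of [y] absorbs. *)
  rewrite !fun_comp, compA, <- (compA (fraction_lift (span_class y))).
  rewrite fraction_liftE, <- compA, <- fun_comp, <- sq, fun_comp, compA.
  now rewrite fraction_liftE.
Qed.

End Universal.

Lemma fraction_universal (D : category) (F : functor C D)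
  (F_inverts : inverts W F) :
  exists! G : functor fraction_cat D, functor_comp G fraction_functor = F.
Proof.
exists (Functor (fraction_lift_laws F_inverts)); split.
- transitivity (Functor (fun_laws F)); [|now destruct F].
  apply functor_eq; intros A B f; simpl.
  apply fraction_lift_uniq; simpl; now rewrite fun_id, comp1r.
- intros G e.
  transitivity (Functor (fun_laws G)); [|now destruct G].
  (* With [F] replaced by the composite, its object map is convertible to that of [G], as
     [functor_eq] requires. *)
  subst F.
  apply functor_eq; intros A B P.
  destruct (fraction_rep P) as [x ->].
  apply fraction_lift_uniq; simpl.
  rewrite <- fun_comp; f_equal; apply fraction_of_denom.
Qed.

End RightFractions.

Unset Implicit Arguments.

Theorem corollary4p13 (C : category) (W : arrow_class C)
  (W_id : forall A : C, W A A (idt A))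
  (W_comp : forall (B D E : C) (v : hom B D) (w : hom D E),
    W B D v -> W D E w ->
    exists (A : C) (u : hom A B), W A E (w ∘ v ∘ u))
  (W_ore : forall (A B D : C) (w : hom A D) (f : hom B D), W A D w ->
    exists (X : C) (w' : hom X B) (f' : hom X A),
      W X B w' /\ w ∘ f' = f ∘ w')
  (W_cancel : forall (A B D : C) (w : hom B D) (f1 f2 : hom A B), W B D w ->
    w ∘ f1 = w ∘ f2 ->
    exists (X : C) (w' : hom X A), W X A w' /\ f1 ∘ w' = f2 ∘ w') :
  inhabited (right_fractions W).
Proof.
constructor.
refine (@RightFractions C W
  (span_equiv_equivalence W_comp W_ore W_cancel)
  (fraction_str W_id W_comp W_ore W_cancel)
  (span_square W_comp W_ore)
  (fun A B E x y X w f Ww sq => fraction_compE W_comp W_ore W_cancel Ww sq)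
  W_id (fraction_of_laws W_id W_comp W_ore W_cancel) _).
split.
- apply fraction_functor_inverts.
- apply fraction_universal.
Qed.
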